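(* For every $k\in\mathbb{N}$, \[ \min_{E(H_1)\cup E(H_2)=E(Q_k)}\max(|V(H_1)|,|V(H_2)|)=\sum_{\ell=0}^{\lfloor k/2\rfloor}\binom{k}{\ell}+(k\bmod 2)\binom{k-1}{\lfloor k/2\rfloor}, \] where the minimum is over all pairs $(H_1,H_2)$ of induced subgraphs of $Q_k$ such that every edge of $Q_k$ is an edge of $H_1$ or of $H_2$.
   Context: $Q_k$ is the $k$-dimensional hypercube: the graph with vertex set $\{0,1\}^k$ in which two vertices are adjacent iff they differ in exactly one coordinate. An induced subgraph $H$ of $Q_k$ is $Q_k[U]$ for some $U\subseteq\{0,1\}^k$, i.e. it contains every edge of $Q_k$ with both endpoints in $U$.
   Formalization: The formal theorem assumes k ≥ 1: for k = 0 the cube has no edges, so a pair of empty induced subgraphs gives minimum 0, whereas the formula gives 1. *)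

(* Defs.v *)
From mathcomp Require Import all_boot.

Set Implicit Arguments.
Unset Strict Implicit.
Unset Printing Implicit Defensive.

(* Edges are unordered pairs, represented as two-element sets of vertices.    *)
Record graph (T : finType) := Graph {
  vertices : {set T};
  edges : {set {set T}}
}.

Definition induced (T : finType) (G : graph T) (U : {set T}) : graph T :=
  Graph U [set e in edges G | e \subset U].

Definition induced_subgraph (T : finType) (H G : graph T) : Prop :=
  exists2 U : {set T}, U \subset vertices G & H = induced G U.

Definition cube (k : nat) : finType := {ffun 'I_k -> bool}.

Definition cube_adj (k : nat) : rel (cube k) :=
  fun x y => #|[set i : 'I_k | x i != y i]| == 1.

Definition hypercube (k : nat) : graph (cube k) :=
  Graph [set: cube k]
        [set e : {set cube k} |
           [exists x, exists y, cube_adj x y && (e == [set x; y])]].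

Definition is_minimum (P : nat -> Prop) (m : nat) : Prop :=
  P m /\ forall n : nat, P n -> m <= n.

(* Main.v *)
(* Let A and B be the complements of V(H_1) and V(H_2).  The edges are covered
   iff A and B are at Hamming distance at least 2.  Let S consist of all
   coordinates if k is even and of all but one if k is odd, so that #|S| = 2m,
   and let c(x) be the number of ones of x in S.  Compressions in the style of
   Daykin and Frankl-Furedi, which push A down and B up with respect to c, keep
   the sizes and the distance condition, so A may be taken to contain every
   point of smaller c than one of its points, and dually for B.  If
   #|A| > #|{c < m}| and #|B| > #|{c > m}|, then A and B both have a point of
   value c = m, and a neighbour of the one in A has value m + 1, hence is in B
   (for m = 0, i.e. k = 1, no two points are at distance 2).  So {c <= m} and {c >= m} are optimal. *)
Require Import Defs.
From mathcomp Require Import all_boot zify.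

Set Implicit Arguments.
Unset Strict Implicit.
Unset Printing Implicit Defensive.

Section Compression.

Variable I : finType.
Implicit Types (x y p : {ffun I -> bool}) (W D S : {set I}).
Implicit Types (A B : {set {ffun I -> bool}}).

(** * Hamming distance and reflections of the cube *)

Definition dist x y := #|[set i | x i != y i]|.

Definition far A B := forall x y, x \in A -> y \in B -> 1 < dist x y.

Definition flip W x : {ffun I -> bool} := [ffun i => x i (+) (i \in W)].

Definition negf x : {ffun I -> bool} := [ffun i => ~~ x i].

Definition agree W p x := [forall i in W, x i == p i].

Definition weight S x := \sum_(i in S) x i.

Lemma agreeP W p x : reflect {in W, x =1 p} (agree W p x).
Proof.
apply: (iffP forall_inP) => [h i /h/eqP //|h i iW]; exact/eqP/h.
Qed.

Lemma distC x y : dist x y = dist y x.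
Proof. by congr #|pred_of_set _|; apply/setP=> i; rewrite !inE eq_sym. Qed.

Lemma dist_flip W x y : dist (flip W x) (flip W y) = dist x y.
Proof.
congr #|pred_of_set _|; apply/setP=> i; rewrite !inE !ffunE.
by case: (x i) (y i) (i \in W) => [] [] [].
Qed.

Lemma flipK W : involutive (flip W).
Proof. by move=> x; apply/ffunP=> i; rewrite !ffunE -addbA addbb addbF. Qed.

Lemma negfK : involutive negf.
Proof. by move=> x; apply/ffunP=> i; rewrite !ffunE negbK. Qed.

Lemma flip0 x : flip set0 x = x.
Proof. by apply/ffunP=> i; rewrite !ffunE inE addbF. Qed.

Lemma agree_neg W p x : agree W (negf p) (flip W x) = agree W p x.
Proof.
apply/agreeP/agreeP => h i iW; have := h i iW; rewrite !ffunE iW.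
  by case: (x i) (p i) => [] [].
by move=> ->; rewrite addbT.
Qed.

(** * Compressions and the distance condition *)

Definition shift W p A x :=
  if agree W p x && (flip W x \notin A) then flip W x else x.

(* With U and V the subsets of W where p is true resp. false, this is the
   classical (U,V)-compression, replacing U by V. *)
Definition compress W p A := shift W p A @: A.

(** Equivalent to [compress W p A] being [A] itself. *)
Definition stable A W p :=
  forall x, x \in A -> agree W p x -> flip W x \in A.

(** A moved point lands outside [A], so it cannot meet a point left in place; two moved points are
    separated by the involution [flip W]. *)
Lemma shift_inj W p A : {in A &, injective (shift W p A)}.
Proof.
move=> x y xA yA; rewrite /shift.
case: ifP => [/andP[_ hx]|_]; case: ifP => [/andP[_ hy]|_] // e.
- exact: (can_inj (flipK W)).
- by rewrite e yA in hx.
- by rewrite -e xA in hy.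
Qed.

Lemma card_compress W p A : #|compress W p A| = #|A|.
Proof. exact/card_in_imset/shift_inj. Qed.

Lemma mem_compress W p A x : x \in compress W p A ->
  x \in A \/ (flip W x \in A /\ agree W p (flip W x)).
Proof.
case/imsetP=> y yA ->; rewrite /shift; case: ifP => [/andP[ay _]|_].
  by right; rewrite flipK.
by left.
Qed.

Lemma mem_compress_agree W p A x : W != set0 ->
  x \in compress W p A -> agree W p x -> flip W x \in A.
Proof.
move=> /set0Pn[i iW] /imsetP[y yA ->]; rewrite /shift; case: ifP.
  by rewrite flipK.
by move=> h ay; rewrite ay /= in h; rewrite (negbFE h).
Qed.

(** Every actual move strictly lowers [f], so equality means that nothing moved. This turns
    minimality of a sum into stability. *)
Lemma sum_compress (f : {ffun I -> bool} -> nat) W p A :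
  (forall x, agree W p x -> f (flip W x) < f x) ->
  \sum_(x in compress W p A) f x <= \sum_(x in A) f x ?= iff
    [forall (x | x \in A), agree W p x ==> (flip W x \in A)].
Proof.
move=> hf; rewrite big_imset /=; last exact: shift_inj.
have -> : [forall (x | x \in A), agree W p x ==> (flip W x \in A)] =
   [forall (x | x \in A), ~~ (agree W p x && (flip W x \notin A))].
  by apply: eq_forallb_in => x _; rewrite negb_and negbK implybE.
apply: leqif_sum => x xA; rewrite /shift.
case: ifP => [/andP[ax _]|_]; last exact: leqif_refl.
by split; [exact/ltnW/hf | rewrite ltn_eqF ?hf].
Qed.

(* The points x and y can only be too close if they differ in a single w of W.
   The smaller compression along W :\: D then puts flip D y in B, at distance
   #|D| - 1 <= 1 from x. *)
Lemma far_compress_half A B W p x y :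
  far A B -> W != set0 ->
  (forall w, w \in W -> exists2 D : {set I},
     (w \in D) && (#|D| <= 2) & stable B (W :\: D) (negf p) /\ D \subset W) ->
  x \in compress W p A -> x \in A ->
  flip W y \in B -> agree W (negf p) (flip W y) -> 1 < dist x y.
Proof.
move=> fAB W0 red xA' xA yB; rewrite agree_neg => ay.
have [ax|] := boolP (agree W p x).
  by rewrite -(dist_flip W) fAB // (mem_compress_agree W0 xA').
rewrite ltnNge; move=> /forall_inPn[w wW xw]; apply/negP => dxy.
have yw : y w = p w by apply: (elimT (agreeP _ _ _) ay).
have eD : [set i | x i != y i] = [set w].
  apply/esym/eqP; rewrite eqEcard cards1 dxy andbT sub1set inE yw.
  by case: (x w) (p w) xw => [] [].
have [D /andP[wD cD] [sB DW]] := red w wW.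
have zB : flip D y \in B.
  have -> : flip D y = flip (W :\: D) (flip W y).
    apply/ffunP=> i; rewrite !ffunE inE.
    have := subsetP DW i; case: (i \in D) (i \in W) (y i) => [] [] [] //= h;
      by have := h isT.
  apply: sB => //; apply/agreeP => i; rewrite inE => /andP[_ iW].
  by rewrite !ffunE iW (elimT (agreeP _ _ _) ay) // addbT.
have := fAB _ _ xA zB; apply/negP; rewrite -leqNgt.
suff -> : dist x (flip D y) = #|D :\ w| by move: cD; rewrite (cardsD1 w D) wD.
congr #|pred_of_set _|; apply/setP=> i; rewrite !inE !ffunE.
have /setP/(_ i) := eD; rewrite !inE => <-.
have : (x i != y i) -> i \in D.
  by have /setP/(_ i) := eD; rewrite !inE => -> /eqP ->.
by case: (x i) (y i) (i \in D) => [] [] [] //= h; have := h isT.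
Qed.

Lemma far_sym A B : far A B -> far B A.
Proof. by move=> fAB x y xB yA; rewrite distC fAB. Qed.

(** If neither point or both points were moved, the distance is that of the original points. The two
    mixed cases are exchanged by swapping [A] with [B] and [p] with [negf p]. *)
Lemma far_compress A B W p :
  far A B -> W != set0 ->
  (forall w, w \in W -> exists2 D : {set I}, (w \in D) && (#|D| <= 2) &
     [/\ stable A (W :\: D) p, stable B (W :\: D) (negf p) & D \subset W]) ->
  far (compress W p A) (compress W (negf p) B).
Proof.
move=> fAB W0 red x y xA' yB'.
have [xA|[xA ax]] := mem_compress xA'; have [yB|[yB ay]] := mem_compress yB'.
- exact: fAB.
- apply: (far_compress_half fAB W0 _ xA' xA yB ay) => w /red[D hD []].
  by exists D.
- rewrite distC.
  apply: (far_compress_half (far_sym fAB) W0 _ yB' yB xA); rewrite negfK //.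
  by move=> w /red[D hD []]; exists D.
- by rewrite -(dist_flip W) fAB.
Qed.

(** * Compressions that lower the weight on [S] *)

Definition descending S W p := weight (S :&: W) (negf p) < weight (S :&: W) p.

Lemma weightID S W x : weight S x = weight (S :&: W) x + weight (S :\: W) x.
Proof. exact: big_setID. Qed.

Lemma weight_neg S x : weight S x + weight S (negf x) = #|S|.
Proof.
rewrite /weight -big_split -sum1_card; apply: eq_bigr => i _.
by rewrite ffunE; case: (x i).
Qed.

Lemma eq_weight S x y : {in S, x =1 y} -> weight S x = weight S y.
Proof. by move=> h; apply: eq_bigr => i /h ->. Qed.

Lemma weight1 w x : weight [set w] x = x w.
Proof. exact: big_set1. Qed.

Lemma descending_flip S W p x :
  descending S W p -> agree W p x -> weight S (flip W x) < weight S x.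
Proof.
move=> d /agreeP ax; rewrite (weightID S W) [ltnRHS](weightID S W).
have -> : weight (S :&: W) (flip W x) = weight (S :&: W) (negf p).
  apply: eq_weight => i; rewrite !inE => /andP[_ iW].
  by rewrite !ffunE iW ax // addbT.
have -> : weight (S :\: W) (flip W x) = weight (S :\: W) x.
  apply: eq_weight => i; rewrite !inE => /andP[/negPf h _].
  by rewrite !ffunE h addbF.
rewrite ltn_add2r (@eq_weight (S :&: W) x p) //.
by move=> i; rewrite inE => /andP[_ /ax].
Qed.

Lemma weight_rem S W w x : w \in W ->
  weight (S :&: W) x = (w \in S) * x w + weight (S :&: (W :\ w)) x.
Proof.
move=> wW; case: (boolP (w \in S)) => wS.
  rewrite (weightID _ [set w]) mul1n -weight1; congr (weight _ _ + weight _ _).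
    by apply/setP => i; rewrite !inE; case: eqP => [->|]; rewrite ?wS ?wW ?andbF.
  by apply/setP => i; rewrite !inE; case: eqP; rewrite ?andbF.
rewrite mul0n add0n; congr weight; apply/setP=> i; rewrite !inE.
by case: eqP => // ->; rewrite (negPf wS).
Qed.

(** Supplies the sets [D] that [far_compress] asks for: deleting [w], or [w] and one further
    coordinate, leaves a descending pattern or an empty one. *)
Lemma descending_reduce S W p w :
  #|~: S| <= 1 -> descending S W p -> w \in W ->
  exists2 D : {set I}, (w \in D) && (#|D| <= 2) & D \subset W /\
    (W :\: D = set0 \/ descending S (W :\: D) p).
Proof.
move=> cS; rewrite /descending => dW wW.
have [easy|] := boolP (weight (S :&: (W :\ w)) (negf p)
                         < weight (S :&: (W :\ w)) p).
  by exists [set w]; [rewrite inE eqxx cards1 | rewrite sub1set; split; [|right]].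
rewrite -leqNgt => hle.
move: dW; rewrite !(weight_rem S _ wW) ffunE.
case: (w \in S) (p w) => [] []; rewrite ?muln0 ?muln1 ?mul0n ?add0n => dW; try lia.
(* What remains is [w] in [S] with [p w] true, where [p] and [negf p] have equal weight on [W :\ w].
   If that weight is 0, [W :\ w] misses [S] and has at most one element, so [D] can be [W].
   Otherwise deleting some [v] in [S] with [p v] false restores the strict inequality. *)
have [h0|] := eqVneq (weight (S :&: (W :\ w)) (negf p)) 0.
  have /esym/eqP := weight_neg (S :&: (W :\ w)) p.
  have -> : weight (S :&: (W :\ w)) p = 0 by lia.
  rewrite h0 cards_eq0 => /eqP Se.
  exists W; last by split=> //; left; rewrite setDv.
  rewrite wW; have := cardsD1 w W; rewrite wW => ->.
  rewrite add1n ltnS (leq_trans _ cS) //.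
  apply/subset_leq_card/subsetP => i iW; rewrite inE; apply/negP => iS.
  by have := in_set0 i; rewrite -Se inE iS iW.
rewrite sum_nat_eq0 => /forall_inPn[v].
rewrite !inE => /and3P[vS vw vW] pv.
exists [set w; v]; first by rewrite !inE eqxx cards2; case: (_ != _).
split; first by apply/subsetP=> i; rewrite !inE => /orP[] /eqP ->.
have vW' : v \in W :\ w by rewrite !inE vw.
right; move: dW hle; rewrite !(weight_rem S _ vW') vS mul1n.
have -> : W :\: [set w; v] = (W :\ w) :\ v by rewrite setDDl.
by move: pv; rewrite ffunE; case: (p v) => //= _; lia.
Qed.

(** * Reaching a fully compressed pair *)

Definition all_stable S A B :=
  forall W p, descending S W p -> stable A W p /\ stable B W (negf p).

Lemma descending_neq0 S W p : descending S W p -> W != set0.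
Proof. by apply: contraTneq => ->; rewrite /descending setI0 /weight !big_set0. Qed.

Lemma descending_flipN S W p x :
  descending S W p -> agree W (negf p) x ->
  weight S (negf (flip W x)) < weight S (negf x).
Proof.
move=> d ax.
have -> : negf (flip W x) = flip W (negf x).
  by apply/ffunP=> i; rewrite !ffunE addNb.
apply: descending_flip d _; apply/agreeP => i iW.
by rewrite ffunE (elimT (agreeP _ _ _) ax) // ffunE negbK.
Qed.

Lemma exists_all_stable S A B : #|~: S| <= 1 -> far A B ->
  exists A' B', [/\ far A' B', #|A'| = #|A|, #|B'| = #|B| & all_stable S A' B'].
Proof.
move=> cS.
(* Descending compressions push [A] down and [B] up, so neither summand can grow; a pair of least
   potential is sought. *)
pose potential A B := \sum_(x in A) weight S x + \sum_(x in B) weight S (negf x).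
have [n] := ubnP (potential A B); elim: n A B => // n IHn A B leAB fAB.
have [|nmin] := boolP [exists A' : {set {ffun I -> bool}},
    exists B' : {set {ffun I -> bool}},
   [&& [forall x in A', forall y in B', 1 < dist x y],
     #|A'| == #|A|, #|B'| == #|B| & potential A' B' < potential A B]].
  case/existsP=> A' /existsP[B' /and4P[/forall_inP f /eqP <- /eqP <- lt]].
  by apply: IHn => [|x y xA yB]; [lia|apply: (forall_inP (f x xA))].
exists A, B; split=> // W p.
(* At a minimum, stability is proved by induction on the size of [W]: stability for the smaller
   [W :\: D] makes compression along [W] keep the distance condition, and minimality then forces
   equality of potentials. *)
have [m] := ubnP #|W|; elim: m W => // m IHm W leW dW.
have W0 := descending_neq0 dW.
have red w : w \in W -> exists2 D : {set I}, (w \in D) && (#|D| <= 2) &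
     [/\ stable A (W :\: D) p, stable B (W :\: D) (negf p) & D \subset W].
  move=> wW; have [D /andP[wD cD] [DW h]] := descending_reduce cS dW wW.
  exists D; first by rewrite wD.
  case: h => [-> | /IHm[]]; try by split.
    by split=> // x; rewrite flip0.
  rewrite cardsD (setIidPr DW); have := subset_leq_card DW.
  by have := cardsD1 w D; rewrite wD; lia.
have fc := far_compress fAB W0 red.
have leif := leqif_add
  (sum_compress A (fun x => @descending_flip S W p x dW))
  (sum_compress B (fun x => @descending_flipN S W p x dW)).
have : potential A B <= potential (compress W p A) (compress W (negf p) B).
  rewrite leqNgt; apply: contra nmin => lt.
  apply/existsP; exists (compress W p A).
  apply/existsP; exists (compress W (negf p) B).
  rewrite !card_compress !eqxx lt !andbT.
  by apply/forall_inP => x xA; apply/forall_inP => y yB; apply: fc.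
rewrite (geq_leqif leif) => /andP[/forall_inP sA /forall_inP sB].
by split=> x => [/sA/implyP|/sB/implyP].
Qed.

Lemma flip_diff x y : flip [set i | x i != y i] x = y.
Proof.
by apply/ffunP=> i; rewrite !ffunE inE; case: (x i) (y i) => [] [].
Qed.

(** Any point is carried to any lighter one by a single descending flip, so stable pairs are closed
    under all changes of weight in the right direction. *)
Lemma descending_diff S x y :
  weight S y < weight S x -> descending S [set i | x i != y i] x.
Proof.
set W := [set i | _]; rewrite /descending (weightID S W y) (weightID S W x).
have -> : weight (S :\: W) y = weight (S :\: W) x.
  by apply: eq_weight => i; rewrite !inE negbK => /andP[/eqP ->].
have -> : weight (S :&: W) y = weight (S :&: W) (negf x).
  apply: eq_weight => i; rewrite !inE ffunE.
  by case: (x i) (y i) => [] []; rewrite ?andbF.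
by rewrite ltn_add2r.
Qed.

Lemma all_stable_lower S A B x y : all_stable S A B ->
  x \in A -> weight S y < weight S x -> y \in A.
Proof.
move=> st xA /descending_diff/st[sA _]; rewrite -(flip_diff x y).
by apply: sA => //; apply/agreeP.
Qed.

Lemma all_stable_upper S A B x y : all_stable S A B ->
  y \in B -> weight S y < weight S x -> x \in B.
Proof.
move=> st yB /descending_diff/st[_ sB]; rewrite -[x](flip_diff y).
have -> : [set i | y i != x i] = [set i | x i != y i].
  by apply/setP=> i; rewrite !inE eq_sym.
apply: sB => //; apply/agreeP => i; rewrite inE ffunE.
by case: (x i) (y i) => [] [].
Qed.

Lemma far_small S A B m : #|~: S| <= 1 -> #|S| = m.*2 -> 0 < #|I| -> far A B ->
  #|[set x | weight S x < m]| < #|A| ->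
  #|[set x | m < weight S x]| < #|B| -> False.
Proof.
move=> cS eS I0 /(exists_all_stable cS)[A' [B' [fAB <- <- st]]] hA hB.
have [x xA wx] : exists2 x, x \in A' & m <= weight S x.
  suff /subsetPn[x xA] : ~~ (A' \subset [set x | weight S x < m]).
    by rewrite inE -leqNgt; exists x.
  by apply: contraL hA => /subset_leq_card; rewrite -leqNgt.
have [y yB wy] : exists2 y, y \in B' & weight S y <= m.
  suff /subsetPn[y yB] : ~~ (B' \subset [set x | m < weight S x]).
    by rewrite inE -leqNgt; exists y.
  by apply: contraL hB => /subset_leq_card; rewrite -leqNgt.
(* If [y] is lighter than [x], it lies in both sets, at distance 0 from itself. Otherwise both
   weights equal [m]. *)
have [lt|le] := ltnP (weight S y) (weight S x).
  have yA := all_stable_lower st xA lt.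
  have := fAB _ _ yA yB; rewrite /dist.
  by rewrite (_ : [set i | _] = set0) ?cards0 //; apply/setP=> i; rewrite !inE eqxx.
have [m0|m0] := posnP m.
  have := fAB _ _ xA yB; rewrite ltnNge => /negP; apply.
  apply: leq_trans (max_card _) _; rewrite -cardsT -(setUCr S).
  by rewrite (leq_trans (leq_card_setU _ _)) // eS m0.
(* Since [x] has weight [m], less than [m.*2], some coordinate in [S] is 0. Raising it gives a
   neighbour heavier than [y], hence in [B']. *)
have [i iS xi] : exists2 i, i \in S & ~~ x i.
  have : weight S (negf x) != 0 by have := weight_neg S x; lia.
  rewrite sum_nat_eq0 => /forall_inPn[i iS]; rewrite ffunE => h.
  by exists i => //; case: (x i) h.
have zB : flip [set i] x \in B'.
  apply: (all_stable_upper st yB).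
  apply: leq_ltn_trans (_ : weight S x < _); first by lia.
  rewrite /weight !(big_setD1 i iS) /= ffunE inE eqxx (negPf xi) add0n /= add1n ltnS.
  by apply: leq_sum => j; rewrite !inE ffunE inE => /andP[/negPf -> _]; rewrite addbF.
have := fAB _ _ xA zB; rewrite /dist (_ : [set j | _] = [set i]) ?cards1 //.
apply/setP=> j; rewrite !inE ffunE inE.
by case: (x j) (j == i) => [] [].
Qed.

(** * Counting the layers *)

Definition low S m := [set x | weight S x <= m].

Definition high S m := [set x | m <= weight S x].

Lemma card_high S m : #|S| = m.*2 -> #|high S m| = #|low S m|.
Proof.
move=> eS; rewrite -(card_imset _ (can_inj negfK)).
apply: eq_card => x; rewrite inE; apply/imsetP/idP => [[y + ->]|wx].
  by rewrite inE; have := weight_neg S y; lia.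
exists (negf x); last by rewrite negfK.
by rewrite inE; have := weight_neg S x; lia.
Qed.

Lemma weight_mem S (X : {set I}) : weight S [ffun i => i \in X] = #|S :&: X|.
Proof.
rewrite /weight -sum1_card [RHS](eq_bigl (fun i => (i \in S) && (i \in X))).
  by rewrite big_mkcondr; apply: eq_bigr => i _; rewrite ffunE; case: ifP.
by move=> i; rewrite inE.
Qed.

(** Fixing the coordinates outside [S] to be 1 leaves a bijection with the [n]-subsets of [S]. *)
Lemma card_weight S n :
  #|[set x | (weight S x == n) && [forall i in ~: S, x i]]| = 'C(#|S|, n).
Proof.
pose f (X : {set I}) : {ffun I -> bool} := [ffun i => (i \in X :|: ~: S)].
have fX (X : {set I}) : X \subset S -> S :&: (X :|: ~: S) = X.
  by move=> XS; rewrite setIUr setICr setU0 (setIidPr XS).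
rewrite -cards_draws -(@card_in_imset _ _ f) => [|X Y].
  apply: eq_card => x; rewrite inE; apply/andP/imsetP.
    case=> /eqP wx /forall_inP xS; exists (S :&: [set i | x i]).
      rewrite inE subsetIl -weight_mem -wx; apply/eqP/eq_weight => i _.
      by rewrite ffunE inE.
    apply/ffunP=> i; rewrite ffunE !inE; have := xS i; rewrite inE.
    by case: (i \in S) (x i) => [] [] //= h; rewrite h.
  case=> X; rewrite inE => /andP[XS /eqP cX] ->.
  rewrite weight_mem fX // cX eqxx; split=> //.
  by apply/forall_inP => i; rewrite ffunE !inE orbC => ->.
rewrite !inE => /andP[XS _] /andP[YS _] /ffunP e.
rewrite -(fX _ XS) -(fX _ YS); congr (S :&: _).
by apply/setP=> i; have := e i; rewrite !ffunE.
Qed.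

Lemma card_low_setT n : #|low setT n| = \sum_(0 <= l < n.+1) 'C(#|I|, l).
Proof.
have cw l : #|[set x | weight setT x == l]| = 'C(#|I|, l).
  rewrite -cardsT -card_weight; apply: eq_card => x; rewrite !inE.
  suff -> : [forall i in ~: setT, x i] by rewrite andbT.
  by apply/forall_inP => i; rewrite !inE.
elim: n => [|n IHn].
  by rewrite big_nat1 -cw; apply: eq_card => x; rewrite !inE leqn0.
rewrite big_nat_recr //= -IHn -cw -cardsUI.
rewrite [X in _ + X](_ : _ = 0) ?addn0.
  by apply: eq_card => x; rewrite !inE leq_eqVlt orbC.
apply: eq_card0 => x; rewrite !inE; apply/negbTE/negP => /andP[wx /eqP e].
by rewrite e ltnn in wx.
Qed.

(** Ignoring [i0] admits, beyond the points of total weight at most [n], those with a 1 at [i0] and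
    exactly [n] ones elsewhere; these give the extra binomial. *)
Lemma card_low_setC1 i0 n :
  #|low [set~ i0] n| = \sum_(0 <= l < n.+1) 'C(#|I|, l) + 'C(#|I|.-1, n).
Proof.
have wT x : weight setT x = x i0 + weight [set~ i0] x.
  by rewrite (weightID _ [set i0]) setTI weight1 setTD.
rewrite -card_low_setT -(cardsC1 i0) -card_weight.
have eN (x : {ffun I -> bool}) : [forall i in ~: [set~ i0], x i] = x i0.
  rewrite setCK; apply/forall_inP/idP => [->|h i]; rewrite ?inE //.
  by move/eqP->.
rewrite -cardsUI [X in _ + X](_ : _ = 0) ?addn0.
  apply: eq_card => x; rewrite !inE eN wT.
  by case: (x i0); rewrite ?andbT ?andbF ?orbF //= add1n orbC -leq_eqVlt.
apply: eq_card0 => x; rewrite !inE eN wT.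
by apply/negbTE/negP => /andP[wx /andP[/eqP e xi]]; rewrite e xi ltnn in wx.
Qed.

End Compression.

(** * Edge covers of the hypercube *)

Lemma ltn_cardsC (T : finType) (A B : {set T}) :
  #|A| < #|B| -> #|~: B| < #|~: A|.
Proof. by have := cardsC A; have := cardsC B; lia. Qed.

Lemma edge_hypercube k (x y : cube k) :
  cube_adj x y -> [set x; y] \in edges (hypercube k).
Proof.
move=> h; rewrite inE; apply/existsP; exists x; apply/existsP; exists y.
by rewrite h /=.
Qed.

Lemma cover_far k (U1 U2 : {set cube k}) : 0 < k ->
  edges (induced (hypercube k) U1) :|: edges (induced (hypercube k) U2)
    = edges (hypercube k) ->
  far (~: U1) (~: U2).
Proof.
move=> k0 cov.
have nadj x y : cube_adj x y -> ~ (x \notin U1 /\ (x \notin U2 \/ y \notin U2)).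
  move=> /edge_hypercube; rewrite -cov => + [x1 xy2].
  rewrite inE ![_ \in edges (induced _ _)]inE.
  case/orP => /andP[_]; rewrite subUset !sub1set => /andP[xU yU].
    by rewrite xU in x1.
  by case: xy2; rewrite ?xU ?yU.
move=> x y; rewrite !inE => x1 y2; rewrite ltnNge; apply/negP.
rewrite leq_eqVlt => /orP[xy|]; first by apply: (nadj x y) => //; split; [|right].
rewrite ltnS leqn0 cards_eq0 => /eqP/setP xy.
have {}xy : x = y.
  by apply/ffunP => i; have := xy i; rewrite !inE => /negbFE/eqP.
(* At distance 0 the common point misses both sets, so any edge at it is uncovered; [0 < k] provides
   one, along coordinate 0. *)
apply: (nadj x (flip [set Ordinal k0] x)).
  rewrite /cube_adj -(cards1 (Ordinal k0)); apply/eqP/eq_card => i.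
  by rewrite !inE !ffunE inE; case: (x i) (i == _) => [] [].
by rewrite xy in x1 *; split; [|left].
Qed.

Lemma weight_adj k (S : {set 'I_k}) (x y : cube k) :
  cube_adj x y -> weight S y <= (weight S x).+1.
Proof.
move=> /cards1P[i /setP xy].
have e j : j != i -> y j = x j.
  by move=> /negPf ji; have := xy j; rewrite !inE ji => /negbFE/eqP.
rewrite (weightID S [set i] x) (weightID S [set i] y).
have -> : weight (S :\: [set i]) y = weight (S :\: [set i]) x.
  by apply: eq_weight => j; rewrite !inE => /andP[/e].
suff : weight (S :&: [set i]) y <= 1 by lia.
rewrite (leq_trans (leq_addr (weight (S :&: [set i]) (negf y)) _)) // weight_neg.
by rewrite -(cards1 i) subset_leq_card // subsetIr.
Qed.

(** Weights along an edge differ by at most 1, so no edge joins weight below [m] to weight above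
    [m]. *)
Lemma low_high_cover k (S : {set 'I_k}) m :
  edges (induced (hypercube k) (low S m)) :|:
  edges (induced (hypercube k) (high S m)) = edges (hypercube k).
Proof.
apply/setP=> e; rewrite inE ![_ \in edges (induced _ _)]inE -andb_orr.
apply: andb_idr; rewrite inE => /existsP[x /existsP[y /andP[xy /eqP ->]]].
have yx : cube_adj y x by move: xy; rewrite /cube_adj -!/(dist _ _) distC.
rewrite !subUset !sub1set !inE.
by have := weight_adj S xy; have := weight_adj S yx; lia.
Qed.

Lemma minimum_low k (S : {set 'I_k}) m :
  0 < k -> #|~: S| <= 1 -> #|S| = m.*2 ->
  is_minimum
    (fun m : nat =>
       exists H1 H2 : graph (cube k),
         [/\ induced_subgraph H1 (hypercube k),
             induced_subgraph H2 (hypercube k),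
             edges H1 :|: edges H2 = edges (hypercube k) &
             m = maxn #|vertices H1| #|vertices H2|])
    #|low S m|.
Proof.
move=> k0 cS eS; split.
  exists (induced (hypercube k) (low S m)), (induced (hypercube k) (high S m)).
  split; last by rewrite /= card_high // maxnn.
  - by exists (low S m); rewrite ?subsetT.
  - by exists (high S m); rewrite ?subsetT.
  - exact: low_high_cover.
move=> _ [_ [_ [[U1 _ ->] [U2 _ ->] /(cover_far k0) fU ->]]] /=.
(* Were both vertex sets smaller than [low S m], which is as large as [high S m], their complements
   would exceed the complements of [high S m] and [low S m], against [far_small]. *)
rewrite leqNgt gtn_max; apply/negP => /andP[lt1 lt2].
apply: (far_small cS eS _ fU); first by rewrite card_ord.
  rewrite (_ : [set x | _] = ~: high S m).
    by apply: ltn_cardsC; rewrite card_high.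
  by apply/setP => x; rewrite !inE -ltnNge.
rewrite (_ : [set x | _] = ~: low S m).
  exact: ltn_cardsC.
by apply/setP => x; rewrite !inE -ltnNge.
Qed.

Theorem theorem3 (k : nat) (k_gt0 : 0 < k) :
  is_minimum
    (fun m : nat =>
       exists H1 H2 : graph (cube k),
         [/\ induced_subgraph H1 (hypercube k),
             induced_subgraph H2 (hypercube k),
             edges H1 :|: edges H2 = edges (hypercube k) &
             m = maxn #|vertices H1| #|vertices H2|])
    (\sum_(0 <= l < (k %/ 2).+1) 'C(k, l) + (k %% 2) * 'C(k - 1, k %/ 2)).
Proof.
rewrite modn2 divn2 subn1; have := odd_double_half k.
case: (odd k) => /= ek.
  (* For odd [k], dropping one coordinate leaves an [S] of even size [k./2.*2]. *)
  pose i0 := Ordinal k_gt0.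
  have := card_low_setC1 i0 k./2; rewrite card_ord mul1n => <-.
  apply: minimum_low => //; first by rewrite setCK cards1.
  by rewrite cardsC1 card_ord -{1}ek.
have := card_low_setT 'I_k k./2; rewrite card_ord mul0n addn0 => <-.
apply: minimum_low => //; first by rewrite setCT cards0.
by rewrite cardsT card_ord -{1}ek.
Qed.
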